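(* There is an increasing sequence of integers $(k_i)_{i\in\mathbb{N}}$ and an infinite sequence of graphs $(G_i)_{i\in\mathbb{N}}$ such that $\mathbf{tw}(G_i)=\Omega(k_i\log k_i)$ and $G_i$ does not contain $k_i\cdot\theta_{r}$ as a minor, for every integer $r\geq 2$.
   Context: Graphs are finite, undirected, loopless, and may have multiple edges. $\mathbf{tw}(G)$ denotes the treewidth of $G$ (minimum over tree-decompositions of the maximum bag size minus one). $H$ is a minor of $G$ if $H$ can be obtained from $G$ by vertex removals, edge removals and edge contractions (parallel edges arising from contractions are kept, loops are discarded). $\theta_r$ is the graph with two vertices and $r$ parallel edges, and $k\cdot J$ denotes the disjoint union of $k$ copies of a graph $J$. The sequences do not depend on $r$. Logarithms are binary. *)

(* Defs.v *)
From mathcomp Require Import all_boot all_order all_algebra.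
From mathcomp Require Import all_classical all_reals all_analysis.

Set Implicit Arguments.
Unset Strict Implicit.
Unset Printing Implicit Defensive.

Local Open Scope nat_scope.

(* A finite loopless multigraph: [nedges x y] is the number of edges joining x
   and y.  The empty graph is allowed, so that vertex removal is total. *)
Record mgraph := MGraph {
  vert :> finType;
  nedges : vert -> vert -> nat;
  nedges_sym : forall x y, nedges x y = nedges y x;
  nedges_loopless : forall x, nedges x x = 0 }.

Definition mgraph_iso (G H : mgraph) : Prop :=
  exists f : G -> H,
    bijective f /\ forall x y, nedges (f x) (f y) = nedges x y.

Section Operations.
Variable G : mgraph.

Definition del_vertex_mult (v : G) (x y : {x : G | x != v}) : nat :=
  nedges (val x) (val y).

Lemma del_vertex_sym v x y : @del_vertex_mult v x y = del_vertex_mult y x.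
Proof. exact: nedges_sym. Qed.

Lemma del_vertex_loopless v x : @del_vertex_mult v x x = 0.
Proof. exact: nedges_loopless. Qed.

Definition del_vertex (v : G) : mgraph :=
  MGraph (@del_vertex_sym v) (@del_vertex_loopless v).

(* One of the parallel edges between u and v is removed. *)
Definition del_edge_mult (u v x y : G) : nat :=
  nedges x y - ([set x; y] == [set u; v]).

Lemma del_edge_sym u v x y : del_edge_mult u v x y = del_edge_mult u v y x.
Proof. by rewrite /del_edge_mult nedges_sym finset.setUC. Qed.

Lemma del_edge_loopless u v x : del_edge_mult u v x x = 0.
Proof. by rewrite /del_edge_mult nedges_loopless. Qed.

Definition del_edge (u v : G) : mgraph :=
  MGraph (del_edge_sym u v) (del_edge_loopless u v).

(* Contraction of an edge uv: v disappears and u stands for the merged vertex;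
   an edge vy with y != u becomes an edge uy, and the edges between u and v,
   which become loops, are discarded. *)
Definition contract_mult (u v : G) (x y : {x : G | x != v}) : nat :=
  if x == y then 0
  else nedges (val x) (val y) + (val x == u) * nedges v (val y)
       + (val y == u) * nedges (val x) v.

Lemma contract_sym u v x y : @contract_mult u v x y = contract_mult u y x.
Proof.
rewrite /contract_mult eq_sym; case: eqP => // _.
by rewrite (nedges_sym (val x)) (nedges_sym v) (nedges_sym (val x)) addnAC.
Qed.

Lemma contract_loopless u v x : @contract_mult u v x x = 0.
Proof. by rewrite /contract_mult eqxx. Qed.

Definition contract_edge (u v : G) : mgraph :=
  MGraph (@contract_sym u v) (@contract_loopless u v).

End Operations.

Inductive minor_step (G : mgraph) : mgraph -> Prop :=
| StepVertex (v : G) : minor_step G (del_vertex v)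
| StepEdge (u v : G) : 0 < nedges u v -> minor_step G (del_edge u v)
| StepContract (u v : G) : 0 < nedges u v -> minor_step G (contract_edge u v).

Inductive minor (H : mgraph) : mgraph -> Prop :=
| MinorIso (G : mgraph) : mgraph_iso G H -> minor H G
| MinorStep (G G' : mgraph) : minor_step G G' -> minor H G' -> minor H G.

Definition theta_mult (r : nat) (x y : bool) : nat := if x == y then 0 else r.

Lemma theta_sym r x y : theta_mult r x y = theta_mult r y x.
Proof. by rewrite /theta_mult eq_sym. Qed.

Lemma theta_loopless r x : theta_mult r x x = 0.
Proof. by rewrite /theta_mult eqxx. Qed.

Definition theta (r : nat) : mgraph := MGraph (theta_sym r) (theta_loopless r).

Definition copies_mult (k : nat) (J : mgraph) (x y : 'I_k * J) : nat :=
  if x.1 == y.1 then nedges x.2 y.2 else 0.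

Lemma copies_sym k J x y : @copies_mult k J x y = copies_mult y x.
Proof. by rewrite /copies_mult eq_sym nedges_sym. Qed.

Lemma copies_loopless k J x : @copies_mult k J x x = 0.
Proof. by rewrite /copies_mult eqxx nedges_loopless. Qed.

Definition copies (k : nat) (J : mgraph) : mgraph :=
  MGraph (@copies_sym k J) (@copies_loopless k J).

Definition is_tree (T : finType) (e : rel T) : Prop :=
  [/\ symmetric e, irreflexive e, 0 < #|T|,
      forall x y, connect e x y
    & forall c : seq T, 2 < size c -> ~ ucycle e c].

Record tree_decomposition (G : mgraph) := TreeDecomposition {
  node : finType;
  adj : rel node;
  bag : node -> {set G};
  adj_tree : is_tree adj;
  bag_vertex : forall v : G, exists t, v \in bag t;
  bag_edge : forall u v : G, 0 < nedges u v ->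
    exists t, (u \in bag t) && (v \in bag t);
  bag_connected : forall (v : G) (s t : node), v \in bag s -> v \in bag t ->
    connect [rel a b | [&& adj a b, v \in bag a & v \in bag b]] s t }.

(* Truncated predecessor: the empty graph gets width 0 instead of -1. *)
Definition width (G : mgraph) (D : tree_decomposition G) : nat :=
  (\max_(t : node D) #|bag t|).-1.

Definition has_width (G : mgraph) (w : nat) : bool :=
  `[< exists D : tree_decomposition G, width D = w >].

Lemma trivial_tree : @is_tree unit (fun _ _ => false).
Proof.
split=> //; first by rewrite card_unit.
- by move=> [] []; exact: connect0.
- by move=> [|[] [|[] c]].
Qed.

Lemma has_width_ex (G : mgraph) : exists w, has_width G w.
Proof.
have conn (v : G) (s t : unit) : v \in [set: G] -> v \in [set: G] ->
    connect [rel a b : unit | [&& false, v \in [set: G] & v \in [set: G]]] s t.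
  by move=> _ _; case: s; case: t; exact: connect0.
have cov (v : G) : exists t : unit, v \in [set: G] by exists tt; rewrite inE.
have cove (u v : G) : 0 < nedges u v ->
    exists t : unit, (u \in [set: G]) && (v \in [set: G]).
  by exists tt; rewrite !inE.
pose D := @TreeDecomposition G unit _ (fun=> [set: G]) trivial_tree cov cove conn.
by exists (width D); apply/asboolP; exists D.
Qed.

Definition treewidth (G : mgraph) : nat := ex_minn (has_width_ex G).

Definition log2 (R : realType) (x : R) : R := (ln x / ln 2)%R.

(* Main.v *)
Require Import Defs.
From mathcomp Require Import all_boot all_order all_algebra.
From mathcomp Require Import all_classical all_reals all_analysis.
From mathcomp Require Import zify.
Import numFieldNormedType.Exports.

Set Implicit Arguments.
Unset Strict Implicit.
Unset Printing Implicit Defensive.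

(** The graphs are random: an n-vertex multigraph is given by 256 n ordered
    pairs of vertices (loops being dropped), and a counting argument produces a
    choice of pairs with two properties.

    The first property makes the treewidth linear in n.  A graph of treewidth
    at most n/8 - 1 has two vertex sets of size at least n/8 with no edge
    between them ([small_treewidth_separation]): some node of the tree has only
    branches carrying at most n/2 vertices each, and grouping these branches
    yields the two sides.  For a fixed couple of sets of size at least n/8, at
    most a fraction (63/64)^(256 n) of the configurations avoids all pairs
    between them, which beats the 4^n choices of the couple
    ([separated_rare]).

    The second property makes disjoint cycles scarce.  A subgraph containing a
    cycle is replaced by a cruder object, a dense set: a nonempty set X of
    vertices spanning at least |X| edges.  Each copy of theta_r with r >= 2 is
    dense, and dense sets can be pulled back along minor operations without
    losing disjointness ([dense_packing_minor]), so a minor k . theta_r forces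
    k disjoint dense sets.  The expected number of dense sets of size l is at
    most D^l with D = 16 * 256 = 2^12 ([loaded_weight]), hence some
    configuration has at most 2 D^(g+1) dense sets of size at most g.  Larger
    ones are at least g + 1 vertices big, so fewer than n / g of them are
    disjoint.

    With N = D^(2g) and n = g N, both kinds together number fewer than
    k = 2 N, while k log k = 2 N (24 g + 1) is of the order of n, thus of the
    order of the treewidth. *)

(** * Packings of dense sets and minors *)

Definition degree_sum (G : mgraph) (X : {set G}) : nat :=
  \sum_(x in X) \sum_(y in X) nedges x y.

(** [degree_sum] counts every edge inside X twice, whence the factor 2: G[X]
    has at least |X| edges.  Compared with containing a cycle, this condition
    survives the undoing of a contraction by mere counting. *)
Definition dense (G : mgraph) (X : {set G}) : bool :=
  (0 < #|X|) && (2 * #|X| <= degree_sum X).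

Definition dense_packing (k : nat) (G : mgraph) : Prop :=
  exists X : 'I_k -> {set G},
    (forall i, dense (X i)) /\ (forall i j, i != j -> [disjoint X i & X j]).

(** Covers isomorphisms, vertex deletions and edge deletions at once. *)
Lemma dense_packing_inj k (G H : mgraph) (f : H -> G) :
  injective f -> (forall x y, nedges x y <= nedges (f x) (f y)) ->
  dense_packing k H -> dense_packing k G.
Proof.
move=> f_inj le_f [X [Xd Xdisj]]; exists (fun i => f @: X i); split=> [i|i j nij].
  have := Xd i; rewrite /dense card_imset //.
  case/andP=> -> /leq_trans-> //=.
  rewrite /degree_sum big_imset /=; last by move=> ? ? _ _ /f_inj.
  apply: leq_sum => x _; rewrite big_imset /=; last by move=> ? ? _ _ /f_inj.
  exact: leq_sum.
have := Xdisj _ _ nij; rewrite -!setI_eq0 => /eqP XX.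
by rewrite -finset.imsetI ?XX ?finset.imset0 // => ? ? _ _ /f_inj.
Qed.

(** When X contains the merged vertex, adding v restores the contracted edge:
    one more vertex and at least one more edge. *)
Definition uncontract (G : mgraph) (u v : G) (X : {set contract_edge u v}) :
    {set G} :=
  if u \in [set val x | x in X] then v |: [set val x | x in X]
  else [set val x | x in X].

Lemma degree_sum_setU1 (G : mgraph) (v : G) (X : {set G}) : v \notin X ->
  degree_sum (v |: X) = degree_sum X + 2 * \sum_(y in X) nedges v y.
Proof.
move=> vX; rewrite /degree_sum big_setU1 //=.
under [X in _ + X = _]eq_bigr do rewrite big_setU1 //= nedges_sym.
by rewrite big_setU1 //= nedges_loopless big_split /=; lia.
Qed.

(** The edges inside X are those inside its preimage together with the edges
    from v, which the contraction attaches to u.  The edges between u and v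
    became loops, whence the condition y != u. *)
Lemma degree_sum_contract (G : mgraph) (u v : G) (X : {set contract_edge u v}) :
  degree_sum X <= degree_sum [set val x | x in X] +
    (u \in [set val x | x in X]) *
       (2 * \sum_(y in [set val x | x in X] | y != u) nedges v y).
Proof.
set Y := [set val x | x in X].
have -> : degree_sum X = \sum_(x in Y) \sum_(y in Y)
   (if x == y then 0 else nedges x y + (x == u) * nedges v y
      + (y == u) * nedges x v).
  rewrite /degree_sum [RHS]big_imset /=; last by move=> ? ? _ _ /val_inj.
  apply: eq_bigr => x _.
  by rewrite [RHS]big_imset /=; last by move=> ? ? _ _ /val_inj.
have [uY|uY] := boolP (u \in Y); last first.
  rewrite mul0n addn0; apply: leq_sum => x xY; apply: leq_sum => y yY.
  case: ifP => // _.
  have /negPf-> : x != u by apply: contraNneq uY => <-.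
  have /negPf-> : y != u by apply: contraNneq uY => <-.
  by rewrite !mul0n !addn0.
apply: (@leq_trans (\sum_(x in Y) \sum_(y in Y)
   (nedges x y + ((x == u) && (y != u)) * nedges v y
      + ((y == u) && (x != u)) * nedges v x))).
  apply: leq_sum => x _; apply: leq_sum => y _.
  case: eqVneq => [//|nxy]; rewrite (nedges_sym x v).
  case: (eqVneq x u) => [xu|_]; case: (eqVneq y u) => [yu|_] //=.
  by rewrite xu yu eqxx in nxy.
rewrite mul1n /degree_sum.
under eq_bigr do rewrite !big_split /=.
rewrite !big_split /= -addnA leq_add2l mul2n -addnn leq_add //.
  rewrite (bigD1 u) //= [X in _ + X]big1 ?addn0; last first.
    by move=> x /andP[_ /negPf->]; rewrite big1.
  rewrite [leqRHS]big_mkcondr /= eqxx leq_sum // => y _.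
  by case: ifP; rewrite ?mul1n.
rewrite exchange_big /= (bigD1 u) //= [X in _ + X]big1 ?addn0; last first.
  by move=> x /andP[_ /negPf->]; rewrite big1.
rewrite [leqRHS]big_mkcondr /= eqxx leq_sum // => y _.
by case: ifP; rewrite ?mul1n.
Qed.

(** Putting v back adds to the degree sum the edges at v, already counted in X
    except for those towards u, of which there is at least one. *)
Lemma dense_uncontract (G : mgraph) (u v : G) (X : {set contract_edge u v}) :
  0 < nedges u v -> dense X -> dense (uncontract X).
Proof.
move=> uv /andP[X0 Xe]; have := leq_trans Xe (degree_sum_contract X).
rewrite /dense /uncontract; set Y := [set val x | x in X].
have cY : #|Y| = #|X| by rewrite card_imset //; exact: val_inj.
have vY : v \notin Y.
  by apply/imsetP => -[x _ vx]; move: (valP x); rewrite -vx eqxx.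
case: ifP => uY; rewrite ?mul1n ?mul0n ?addn0 ?cY ?X0 // => le.
rewrite degree_sum_setU1 // cardsU1 vY cY /= (bigD1 u) //= (nedges_sym v u).
by rewrite !mulnDr addnCA leq_add // leq_mul2l.
Qed.

Lemma disjoint_uncontract (G : mgraph) (u v : G) (X Y : {set contract_edge u v}) :
  [disjoint X & Y] -> [disjoint uncontract X & uncontract Y].
Proof.
move=> dXY; set X' := [set val x | x in X]; set Y' := [set val x | x in Y].
have dXY' : [disjoint X' & Y'].
  move: dXY; rewrite -!setI_eq0 => /eqP XY.
  by rewrite -finset.imsetI ?XY ?finset.imset0 // => ? ? _ _ /val_inj.
have vn (Z : {set contract_edge u v}) : v \notin [set val x | x in Z].
  by apply/imsetP => -[x _ vx]; move: (valP x); rewrite -vx eqxx.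
rewrite /uncontract; case: ifP => uX; case: ifP => uY //.
- by rewrite (disjointFr dXY' uX) in uY.
- by rewrite -setI_eq0 finset.setIUl finset.setU_eq0 !setI_eq0 disjoints1 vn.
- by rewrite -setI_eq0 finset.setIUr finset.setU_eq0 !setI_eq0 disjoint_sym
             disjoints1 vn dXY'.
Qed.

Lemma dense_packing_step k (G H : mgraph) :
  minor_step G H -> dense_packing k H -> dense_packing k G.
Proof.
case=> [v|u v _|u v uv].
- by apply: (@dense_packing_inj _ _ (del_vertex v) val) => //; exact: val_inj.
- apply: (@dense_packing_inj _ _ (del_edge u v) (fun x => x : G)) => // x y.
  exact: leq_subr.
- case=> X [Xd Xdisj]; exists (fun i => uncontract (X i)); split=> [i|i j nij].
    exact: dense_uncontract.
  exact/disjoint_uncontract/Xdisj.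
Qed.

Lemma dense_packing_minor k (G H : mgraph) :
  minor H G -> dense_packing k H -> dense_packing k G.
Proof.
elim=> {G} [G [f [[g fK gK] fe]]|G G' st _ IH] pH.
  apply: (@dense_packing_inj _ _ _ g) pH => [|x y]; first exact: can_inj gK.
  by rewrite -fe !gK.
exact/(dense_packing_step st)/IH.
Qed.

Lemma dense_packing_theta k r : 1 < r -> dense_packing k (copies k (theta r)).
Proof.
move=> r1; exists (fun i => [set (i, b) | b : bool]); split=> [i|i j nij].
  have inj : injective (fun b : bool => (i, b)) by move=> ? ? [].
  rewrite /dense card_imset // card_bool /degree_sum.
  rewrite big_imset /=; last by move=> ? ? _ _ /inj.
  rewrite (eq_bigr (fun x => \sum_(y : bool) theta_mult r x y)); last first.
    move=> b _; rewrite big_imset /=; last by move=> ? ? _ _ /inj.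
    by apply: eq_bigr => c _; rewrite /copies_mult /= eqxx.
  by rewrite !big_bool /= /theta_mult /=; lia.
rewrite -setI_eq0; apply/eqP/finset.setP => x; rewrite !inE.
apply/negbTE/andP => -[/imsetP[b _ ->] /imsetP[c _ [ij _]]].
by rewrite ij eqxx in nij.
Qed.

(** * Treewidth and balanced separations *)

(** Otherwise a path from s to t that does not use the edge st would close up
    with it into a cycle. *)
Lemma tree_edge_bridge (T : finType) (e : rel T) (s t : T) : is_tree e -> e s t ->
  ~~ connect [rel a b | e a b && ~~ ((a == s) && (b == t))] s t.
Proof.
case=> e_sym e_irr _ _ acyc est; apply/negP => /connectP[p0 + tE].
move=> ep0; case/shortenP: ep0 tE => p ep up _ tE.
have nst : s != t by apply: contraTneq est => ->; rewrite e_irr.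
case: p ep up tE => [|a [|b p]] ep up tE.
- by rewrite tE eqxx in nst.
- by move: tE ep => /= ->; rewrite !eqxx andbF.
apply: (acyc [:: s, a, b & p]) => //; apply/andP; split=> //.
rewrite /cycle rcons_path -tE e_sym est andbT.
by apply: sub_path ep => x y /andP[].
Qed.

Lemma finite_periodic_point (T : finType) (f : T -> T) (x0 : T) :
  exists x, fcycle f (orbit f x).
Proof.
have /loopingP/(_ (order f x0))/trajectP[i lt_i Ei] := looping_order f x0.
exists (iter i f x0); apply/(orbitPcycle 0 3); exists (order f x0 - i).-1.
by rewrite prednK ?subn_gt0 // -iterD subnK ?Ei // ltnW.
Qed.

(** For a minimal set P of classes covering a quarter of V, dropping one class
    leaves less than a quarter; so P covers less than 1/4 + 1/2 of V, and the
    other classes cover at least 7/8 - 3/4 = 1/8. *)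
Lemma grouping (V T : finType) (R : {set V}) (c : V -> T) :
  7 * #|V| <= 8 * #|R| ->
  (forall y, 2 * #|[set v in R | c v == y]| <= #|V|) ->
  exists P : {set T}, #|V| <= 8 * #|[set v in R | c v \in P]| /\
                      #|V| <= 8 * #|[set v in R | c v \notin P]|.
Proof.
move=> bigR smallc; pose A (P : {set T}) := [set v in R | c v \in P].
pose good (P : {set T}) := #|V| <= 4 * #|A P|.
have goodT : good [set: T].
  rewrite /good (_ : A _ = R); first by lia.
  by apply/finset.setP => v; rewrite !inE andbT.
case: (arg_minnP (fun P : {set T} => #|P|) goodT) => P gP minP; exists P.
have cardRE : #|R| = #|A P| + #|[set v in R | c v \notin P]|.
  rewrite -(cardsID [set v | c v \in P] R); congr (_ + _); apply: eq_card => v.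
    by rewrite !inE.
  by rewrite !inE andbC.
have [P0|[y yP]] := set_0Vmem P.
  have A0 : #|A P| = 0.
    by apply/eqP; rewrite cards_eq0 P0; apply/eqP/finset.setP => v;
       rewrite !inE andbF.
  move: gP; rewrite /good -/(A P) A0; lia.
have ngood : ~~ good (P :\ y).
  apply/negP => /minP; rewrite (cardsD1 y P) yP; lia.
have AE : #|A P| <= #|A (P :\ y)| + #|[set v in R | c v == y]|.
  apply: leq_trans (leq_card_setU _ _); apply/subset_leq_card/fintype.subsetP => v.
  by rewrite !inE => /andP[-> ->]; rewrite !andbT; case: eqP.
move: gP ngood (smallc y); rewrite /good -ltnNge -/(A P); lia.
Qed.

Section Node.
Variables (G : mgraph) (D : tree_decomposition G).
Notation T := (node D).

Definition avoiding (t : T) : rel T := [rel a b | [&& adj a b, a != t & b != t]].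

(** The vertices lying strictly on the side of x when node t is removed. *)
Definition branch (t x : T) : {set G} :=
  [set v | (v \notin bag t) &&
           [exists s, (v \in bag s) && connect (avoiding t) x s]].

Lemma avoiding_sym t : connect_sym (avoiding t).
Proof.
case: (adj_tree D) => e_sym _ _ _ _.
apply: sym_connect_sym => a b; rewrite /avoiding /= e_sym.
by congr andb; rewrite andbC.
Qed.

(** The nodes whose bags contain v form a connected set, and t is not one of
    them; so a vertex outside the bag of t lies in one branch at t only. *)
Lemma bags_avoiding (v : G) (t s s' : T) : v \notin bag t ->
  v \in bag s -> v \in bag s' -> connect (avoiding t) s s'.
Proof.
move=> vt vs vs'; apply: connect_sub (bag_connected vs vs') => a b /and3P[ab va vb].
apply: connect1; rewrite /avoiding /= ab /=.
by apply/andP; split; apply: contraNneq vt => <-.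
Qed.

Lemma big_branch_neighbour (t x : T) : x != t ->
  exists2 y, adj t y & branch t x \subset branch t y.
Proof.
move=> nxt; case: (adj_tree D) => _ _ _ conn _.
have /connectP[p0 + xE] := conn t x; move=> tp0; case/shortenP: tp0 xE => -[|y p] /=.
  by move=> _ _ _ xt; rewrite xt eqxx in nxt.
case/andP=> ty py /andP[tp _] _ xE; exists y => //.
have yx : connect (avoiding t) y x.
  apply/connectP; exists p => //.
  elim: p y {ty xE} py tp => //= z p IH y /andP[yz pz].
  rewrite !inE !negb_or => /and3P[ty tz tp].
  rewrite /avoiding /= yz ![_ == t]eq_sym ty tz /=.
  by apply: IH => //; rewrite inE negb_or tz.
apply/fintype.subsetP => v; rewrite !inE => /andP[-> /existsP[s /andP[vs xs]]].
by apply/existsP; exists s; rewrite vs; exact: connect_trans xs.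
Qed.

(** A common vertex v is in no bag of s or t, so its bags would link the two
    sides of the edge st without using that edge. *)
Lemma facing_branches_disjoint (s t : T) : adj s t ->
  [disjoint branch s t & branch t s].
Proof.
move=> st; rewrite -setI_eq0; apply/eqP/finset.setP => v; rewrite !inE.
apply/negP => /andP[/andP[vs /existsP[a /andP[va ta]]]
                    /andP[vt /existsP[b /andP[vb sb]]]].
have /negP[] := tree_edge_bridge (adj_tree D) st.
have sub z : (z == s) || (z == t) -> subrel (avoiding z)
    (connect [rel a b : T | adj a b && ~~ ((a == s) && (b == t))]).
  move=> zst c d /and3P[cd cz dz]; apply: connect1; rewrite /= cd /=.
  by apply: contraTN zst => /andP[/eqP <- /eqP <-];
     rewrite eq_sym negb_or cz eq_sym.
apply: (@connect_trans _ _ b).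
  by apply: connect_sub sb; apply: sub; rewrite eqxx orbT.
apply: (@connect_trans _ _ a).
  apply: connect_sub (bags_avoiding vs vb va).
  by apply: sub; rewrite eqxx.
rewrite avoiding_sym in ta; apply: connect_sub ta.
by apply: sub; rewrite eqxx.
Qed.

(** If each node t had a branch with more than half of the vertices, then
    walking from t to the neighbour p t that starts this branch would
    eventually cycle.  A tree only allows a back-and-forth along one edge, where
    two disjoint branches would both have more than half of the vertices. *)
Lemma centroid_node : exists t : T, forall x, x != t ->
  2 * #|branch t x| <= #|G|.
Proof.
case: (boolP [exists t : T, [forall x, (x != t) ==> (2 * #|branch t x| <= #|G|)]]).
  by case/existsP=> t /forallP tP; exists t => x /(implyP (tP x)).
rewrite negb_exists => /forallP noc.
have /fin_all_exists[p pP] (t : T) :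
    exists y, adj t y /\ #|G| < 2 * #|branch t y|.
  have := noc t; rewrite negb_forall => /existsP[x].
  rewrite negb_imply -ltnNge => /andP[/big_branch_neighbour[y ty sub] lt].
  exists y; split=> //; apply: leq_trans lt _.
  by rewrite leq_mul2l subset_leq_card.
have [e_sym e_irr /card_gt0P[t0 _] _ acyc] := adj_tree D.
have [t pt] := finite_periodic_point p t0.
have sz2 : order p t <= 2.
  rewrite leqNgt -size_orbit; apply/negP => /acyc; apply.
  apply/andP; split; last exact: orbit_uniq.
  by apply: sub_cycle pt => x y /eqP <-; case: (pP x).
have /(orbitPcycle 0 4) itert := pt.
have ppt : p (p t) = t.
  case: (order p t) itert sz2 (order_gt0 p t) => [|[|[|]]] //= ptt _ _.
  by rewrite ptt ptt.
have [tp big1] := pP t; have [_ big2] := pP (p t); rewrite ppt in big2.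
have := max_card (mem (branch t (p t) :|: branch (p t) t)).
have := facing_branches_disjoint tp; rewrite -setI_eq0 => /eqP disj.
by rewrite cardsU disj cards0; lia.
Qed.

(** At a centroid node, adjacent vertices outside the bag share a bag, hence a
    branch; so unions of branches are not joined by edges. *)
Lemma tree_decomposition_separation :
  (forall t : T, 8 * #|bag t| <= #|G|) ->
  exists A B : {set G},
    [/\ #|G| <= 8 * #|A|, #|G| <= 8 * #|B| & forall a b, a \in A -> b \in B ->
        a != b /\ nedges a b = 0].
Proof.
move=> smallbag; have [t tP] := centroid_node.
have /fin_all_exists[h hP] (v : G) : exists s : T, v \in bag s.
  exact: bag_vertex.
pose c v := fingraph.root (avoiding t) (h v).
pose R := ~: bag t.
have cardR : 7 * #|G| <= 8 * #|R|.
  by have := cardsC (bag t); have := smallbag t; rewrite -/R; lia.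
have smallc y : 2 * #|[set v in R | c v == y]| <= #|G|.
  have [->|[v0]] := set_0Vmem [set v in R | c v == y].
    by rewrite cards0.
  rewrite !inE => /andP[v0t /eqP cy].
  have ht : h v0 != t by apply: contraNneq v0t => <-.
  apply: leq_trans (tP _ ht); rewrite leq_mul2l /=.
  apply/subset_leq_card/fintype.subsetP => v; rewrite !inE => /andP[-> /eqP cv] /=.
  apply/existsP; exists (h v).
  rewrite hP /= -fingraph.root_connect; last exact: avoiding_sym.
  by apply/eqP; rewrite [LHS]cy.
have [P [bigA bigB]] := grouping cardR smallc.
exists [set v in R | c v \in P], [set v in R | c v \notin P]; split=> // a b.
rewrite !inE => /andP[at_ ca] /andP[bt cb]; split.
  by apply: contraNneq cb => <-.
apply/eqP; rewrite -leqn0 leqNgt; apply: contraNN cb =>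
  /bag_edge-/(_ D)[s /andP[sa sb]].
suff <- : c a = c b by [].
apply/eqP; rewrite fingraph.root_connect; last exact: avoiding_sym.
apply: (@connect_trans _ _ s).
  by apply: bags_avoiding at_ _ _.
by apply: bags_avoiding bt _ _.
Qed.

End Node.

Lemma small_treewidth_separation (G : mgraph) :
  8 * (treewidth G).+1 <= #|G| ->
  exists A B : {set G},
    [/\ #|G| <= 8 * #|A|, #|G| <= 8 * #|B| & forall a b, a \in A -> b \in B ->
        a != b /\ nedges a b = 0].
Proof.
rewrite /treewidth; case: ex_minnP => w /asboolP[D wD] _ small.
apply: (@tree_decomposition_separation _ D) => t; apply: leq_trans small.
rewrite leq_mul2l /= -wD /width.
apply: leq_trans (leqSpred _).
exact: (@leq_bigmax _ (fun t : node D => #|bag t|)).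
Qed.

(** * Random configurations of pairs *)

Lemma leq_card_bigcup (I T : finType) (P : pred I) (A : I -> {set T}) :
  #|\bigcup_(i | P i) A i| <= \sum_(i | P i) #|A i|.
Proof.
elim/big_rec2: _ => [|i n S _ le]; first by rewrite cards0.
by apply: leq_trans (leq_card_setU _ _) _; rewrite leq_add2l.
Qed.

Section Configurations.
Variables (V : finType) (m : nat).
Implicit Type f : {ffun 'I_m -> V * V}.

Definition config_mult f (x y : V) : nat :=
  if x == y then 0 else \sum_(i < m) ((f i == (x, y)) + (f i == (y, x))).

Lemma config_sym f x y : config_mult f x y = config_mult f y x.
Proof. by rewrite /config_mult eq_sym; under eq_bigr do rewrite addnC. Qed.

Lemma config_loopless f x : config_mult f x x = 0.
Proof. by rewrite /config_mult eqxx. Qed.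

Definition config_graph f : mgraph := MGraph (config_sym f) (config_loopless f).

Definition slots f (X : {set V}) : {set 'I_m} := [set i | f i \in finset.setX X X].

(** The pairs inside X are counted once for each of the two orientations. *)
Lemma degree_sum_config f (X : {set V}) :
  @degree_sum (config_graph f) X <= 2 * #|slots f X|.
Proof.
have one i (s : V -> V -> V * V) : injective (uncurry s) ->
    (forall x y, (s x y \in finset.setX X X) = (x \in X) && (y \in X)) ->
    \sum_(x in X) \sum_(y in X) (f i == s x y) <= (f i \in finset.setX X X).
  move=> s_inj sX; rewrite pair_big /=.
  case: (pickP (fun p : V * V => (p.1 \in X) && (p.2 \in X) && (f i == s p.1 p.2))).
    move=> p /andP[pX /eqP fp]; rewrite (bigD1 p) //= big1 => [|q /andP[_ nqp]].
      by rewrite addn0 fp eqxx sX pX.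
    rewrite fp; case: eqP => // /(s_inj (_, _) (_, _)) pq.
    by rewrite -!surjective_pairing in pq; rewrite pq eqxx in nqp.
  by move=> none; rewrite big1 // => p pX; have := none p; rewrite pX /= => ->.
rewrite /degree_sum /=.
apply: (@leq_trans (\sum_(x in X) \sum_(y in X)
    \sum_(i < m) ((f i == (x, y)) + (f i == (y, x))))).
  apply: leq_sum => x _; apply: leq_sum => y _; rewrite /config_mult.
  by case: ifP.
under eq_bigr do rewrite exchange_big /=.
rewrite exchange_big /= (_ : #|slots f X| = \sum_(i < m) (f i \in finset.setX X X)).
  rewrite big_distrr; apply: leq_sum => i _ /=.
  under eq_bigr do rewrite big_split /=.
  rewrite big_split /= mul2n -addnn leq_add //.
    by apply: (one i (fun x y => (x, y))) => [[? ?] [? ?] //|x y]; rewrite finset.in_setX.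
  apply: (one i (fun x y => (y, x))) => [[? ?] [? ?] [-> ->] //|x y].
  by rewrite finset.in_setX andbC.
by rewrite -sum1dep_card big_mkcond /=; apply: eq_bigr => i _; case: ifP.
Qed.

Lemma card_configs_avoiding (S : {set V * V}) :
  #|[set f : {ffun 'I_m -> V * V} | [forall i, f i \notin S]]|
    = (#|V| * #|V| - #|S|) ^ m.
Proof.
rewrite (_ : _ - _ = #|~: S|); last by rewrite -card_prod -(cardsC S) addKn.
rewrite -[m in RHS]card_ord -card_ffun_on cardsE; apply: eq_card => f.
rewrite !inE /=; apply/forallP/ffun_onP => fS i; first by rewrite inE fS.
by have := fS i; rewrite inE.
Qed.

Lemma card_configs_prescribed (E : {set 'I_m}) (S : {set V * V}) :
  #|[set f : {ffun 'I_m -> V * V} | [forall i in E, f i \in S]]|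
    = #|S| ^ #|E| * (#|V| * #|V|) ^ (m - #|E|).
Proof.
pose F (i : 'I_m) : pred (V * V) := fun z => (i \in E) ==> (z \in S).
transitivity (foldr muln 1 [seq #|F i| | i : 'I_m]).
  rewrite -(@card_family _ (fun=> (V * V)%type) F) cardsE.
  by apply: eq_card => f; rewrite !inE.
rewrite foldrE big_image /=.
rewrite (eq_bigr (fun i => if i \in E then #|S| else #|V| * #|V|)); last first.
  move=> i _; rewrite -card_prod; case: ifP => iE.
    by apply: eq_card => z; rewrite unfold_in /F iE.
  by apply: eq_card => z; rewrite unfold_in /F iE.
rewrite (bigID (mem E)) /=; congr (_ * _).
  by rewrite (eq_bigr (fun=> #|S|)) => [|i ->//]; rewrite prod_nat_const.
rewrite (eq_bigr (fun=> #|V| * #|V|)) => [|i /negPf->//].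
rewrite prod_nat_const; congr (_ ^ _).
by apply/eqP; rewrite -(eqn_add2l #|E|) (cardC (mem E)) card_ord subnKC //
   -[leqRHS]card_ord max_card.
Qed.

(** Union bound over the sets of |X| indices whose pairs fall inside X. *)
Lemma card_configs_slots (X : {set V}) :
  #|[set f : {ffun 'I_m -> V * V} | #|X| <= #|slots f X|]| <=
    'C(m, #|X|) * ((#|X| * #|X|) ^ #|X| * (#|V| * #|V|) ^ (m - #|X|)).
Proof.
set l := #|X|.
pose P (E : {set 'I_m}) :=
  [set f : {ffun 'I_m -> V * V} | [forall i in E, f i \in finset.setX X X]].
apply: (@leq_trans #|\bigcup_(E : {set 'I_m} | #|E| == l) P E|).
  apply/subset_leq_card/fintype.subsetP => f; rewrite inE => lf.
  have [E] : exists E : {set 'I_m}, E \subset slots f X /\ #|E| == l.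
    have /card_gt0P[E] : 0 < #|[set E : {set 'I_m} | (E \subset slots f X) && (#|E| == l)]|.
      by rewrite cards_draws bin_gt0.
    by rewrite inE => /andP[]; exists E.
  case=> /fintype.subsetP sE cE; apply/finset.bigcupP; exists E => //; rewrite inE.
  by apply/forallP => i; apply/implyP => /sE; rewrite inE.
apply: leq_trans (leq_card_bigcup _ _) _.
rewrite (eq_bigr (fun=> (l * l) ^ l * (#|V| * #|V|) ^ (m - l))); last first.
  by move=> E /eqP cE; rewrite card_configs_prescribed cardsX cE.
by rewrite sum_nat_const -[X in 'C(X, _)]card_ord -card_draws cardsE.
Qed.

End Configurations.

(** * Counting configurations *)

Lemma card_set_type (T : finType) : #|{: {set T}}| = 2 ^ #|T|.
Proof. by have := card_powerset [set: T]; rewrite powersetT !cardsT. Qed.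

Lemma leq_bin_exp n l : 'C(n, l) <= 2 ^ n.
Proof.
rewrite -[X in 'C(X, _)]card_ord -card_draws; apply: leq_trans (max_card _) _.
by rewrite card_set_type card_ord.
Qed.

(** A weak form of Stirling's bound, read off the central binomial coefficient
    l! C(2l, l) = 2l (2l - 1) ... (l + 1) >= l^l. *)
Lemma self_exp_leq_fact l : l ^ l <= 4 ^ l * l`!.
Proof.
apply: (@leq_trans ((l + l) ^_ l)).
  rewrite ffact_prod -[X in _ ^ X]card_ord -prod_nat_const.
  by apply: leq_prod => i _; have := ltn_ord i; lia.
rewrite -bin_ffact leq_mul2r -[4]/(2 ^ 2) -expnM mul2n -addnn.
by rewrite leq_bin_exp orbT.
Qed.

Lemma leq_ffact_exp n l : n ^_ l <= n ^ l.
Proof.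
rewrite ffact_prod -[X in _ ^ X]card_ord -prod_nat_const.
by apply: leq_prod => i _; exact: leq_subr.
Qed.

(** The first-moment estimate: the left-hand side bounds the number of couples
    of an l-set X and a configuration with at least l pairs inside X.  The two
    factorials saved by the binomials compensate l^(2l) up to 16^l. *)
Lemma loaded_weight c n l :
  'C(n, l) * ('C(c * n, l) * ((l * l) ^ l * (n * n) ^ (c * n - l)))
    <= (16 * c) ^ l * (n * n) ^ (c * n).
Proof.
have [lt|le] := ltnP (c * n) l; first by rewrite (bin_small lt) mul0n muln0.
have -> : (n * n) ^ (c * n) = (n * n) ^ l * (n * n) ^ (c * n - l).
  by rewrite -expnD subnKC.
rewrite !mulnA leq_mul2r; apply/orP; right.
have H1 : 'C(n, l) * l`! <= n ^ l by rewrite bin_ffact leq_ffact_exp.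
have H2 : 'C(c * n, l) * l`! <= (c * n) ^ l by rewrite bin_ffact leq_ffact_exp.
have H3 := self_exp_leq_fact l.
apply: (@leq_trans ('C(n, l) * 'C(c * n, l) * ((4 ^ l * l`!) * (4 ^ l * l`!)))).
  by rewrite expnMn leq_mul2l leq_mul ?orbT.
apply: (@leq_trans (16 ^ l * ((n ^ l) * (c * n) ^ l))); last first.
  by rewrite !expnMn; lia.
rewrite -[16]/(4 * 4) expnMn.
apply: (@leq_trans (4 ^ l * 4 ^ l * (('C(n, l) * l`!) * ('C(c * n, l) * l`!)))).
  by lia.
by rewrite leq_mul2l leq_mul ?orbT.
Qed.

Lemma sum_exp_leq D k : 1 < D -> \sum_(l < k) D ^ l <= D ^ k.
Proof.
move=> D2; elim: k => [|k IH]; first by rewrite big_ord0.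
rewrite big_ord_recr /= expnS; apply: leq_trans (leq_add IH (leqnn _)) _.
by rewrite addnn -mul2n leq_mul2r D2 orbT.
Qed.

Lemma bernoulli_exp a k : (a + k) * a ^ k <= a * a.+1 ^ k.
Proof.
elim: k => [|k IH]; first by rewrite addn0.
apply: (@leq_trans (a.+1 * (a + k) * a ^ k)).
  by rewrite expnS mulnA leq_mul2r; apply/orP; right; lia.
by rewrite expnS mulnCA -mulnA leq_mul2l IH orbT.
Qed.

(** Powered form of (1 + 1/a)^(a+1) >= 2. *)
Lemma exp_gap a j : 0 < a -> 2 ^ j * a ^ (a.+1 * j) <= a.+1 ^ (a.+1 * j).
Proof.
move=> a0; rewrite !expnM -expnMn.
suff le : 2 * a ^ a.+1 <= a.+1 ^ a.+1 by case: j => [//|j]; rewrite leq_exp2r.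
have le : 2 * a ^ a <= a.+1 ^ a.
  by rewrite -(leq_pmul2l a0); apply: leq_trans (bernoulli_exp a a); lia.
by rewrite !expnS mulnCA leq_mul.
Qed.

Section Counting.
Variables (n c : nat).
Notation V := 'I_n.
Notation config := {ffun 'I_(c * n) -> V * V}.

(** These include the dense sets of size at most g of the configuration graph.
    Loops count here, so that the slots of X are governed by independent,
    identical conditions. *)
Definition loaded_sets (g : nat) (f : config) : {set {set V}} :=
  [set X : {set V} | (#|X| <= g) && (#|X| <= #|slots f X|)].

Lemma card_config : #|{: config}| = (n * n) ^ (c * n).
Proof. by rewrite card_ffun card_prod !card_ord. Qed.

Lemma sum_loaded_sets g : 0 < c ->
  \sum_(f : config) #|loaded_sets g f| <= (16 * c) ^ g.+1 * (n * n) ^ (c * n).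
Proof.
move=> c0; set W := (n * n) ^ (c * n).
under eq_bigr do rewrite -sum1dep_card big_mkcond /=.
rewrite exchange_big /=.
apply: (@leq_trans (\sum_(X : {set V} | #|X| <= g)
    'C(c * n, #|X|) * ((#|X| * #|X|) ^ #|X| * (n * n) ^ (c * n - #|X|)))).
  rewrite [leqRHS]big_mkcond; apply: leq_sum => X _; case: ifP => /= Xg.
    rewrite -big_mkcond sum1dep_card.
    by have := card_configs_slots (c * n) X; rewrite card_ord.
  by rewrite big1.
rewrite (partition_big (fun X : {set V} => inord #|X| : 'I_g.+1) predT) //=.
apply: leq_trans (leq_mul (sum_exp_leq g.+1 _) (leqnn W)); last by lia.
rewrite big_distrl /=; apply: leq_sum => l _.
apply: leq_trans (loaded_weight c n l).
rewrite (eq_bigr (fun=> 'C(c * n, l) * ((l * l) ^ l * (n * n) ^ (c * n - l)))).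
  rewrite sum_nat_const leq_mul2r; apply/orP; right.
  rewrite -[X in 'C(X, _)]card_ord -card_draws.
  apply/subset_leq_card/fintype.subsetP => X; rewrite !inE => /andP[Xg /eqP <-].
  by rewrite inordK.
by move=> X /andP[Xg /eqP <-]; rewrite inordK.
Qed.

(** Markov's inequality for [sum_loaded_sets]. *)
Lemma overloaded_rare g : 0 < c ->
  2 * #|[set f : config | 2 * (16 * c) ^ g.+1 < #|loaded_sets g f|]|
    <= (n * n) ^ (c * n).
Proof.
move=> c0; have pos : 0 < (16 * c) ^ g.+1 by rewrite expn_gt0; lia.
rewrite -(leq_pmul2l pos); apply: leq_trans (sum_loaded_sets g c0).
rewrite mulnA [_ * 2]mulnC mulnC -sum_nat_const [leqRHS](bigID
  (fun f : config =>
    f \in [set f : config | 2 * (16 * c) ^ g.+1 < #|loaded_sets g f|])) /=.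
apply: leq_trans (leq_addr _ _); apply: leq_sum => f.
by rewrite inE => /ltnW.
Qed.

Definition separated (f : config) : bool :=
  [exists AB : {set V} * {set V}, [&& n <= 8 * #|AB.1|, n <= 8 * #|AB.2| &
    [forall i, f i \notin finset.setX AB.1 AB.2]]].

(** Every couple of sets of size at least n/8 has at least n^2/64 pairs between
    them, and with 256 = 64 * 4 pairs per vertex the factor
    (63/64)^(256 n) <= 16^(-n) beats the number 4^n of couples. *)
Lemma separated_rare : 0 < n -> c = 64 * 4 ->
  4 * #|[set f : config | separated f]| <= (n * n) ^ (c * n).
Proof.
move=> n0 cE; set W := (n * n) ^ (c * n); set S := [set f : config | separated f].
have bound : 64 ^ (c * n) * #|S| <= 4 ^ n * (63 ^ (c * n) * W).
  pose big (AB : {set V} * {set V}) := (n <= 8 * #|AB.1|) && (n <= 8 * #|AB.2|).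
  pose P (AB : {set V} * {set V}) :=
    [set f : config | [forall i, f i \notin finset.setX AB.1 AB.2]].
  have le : #|S| <= \sum_(AB | big AB) #|P AB|.
    apply: leq_trans (leq_card_bigcup _ _).
    apply/subset_leq_card/fintype.subsetP => f; rewrite inE => /existsP[AB].
    case/and3P=> A8 B8 fAB; apply/finset.bigcupP; exists AB; last by rewrite inE.
    by rewrite /big A8 B8.
  apply: leq_trans (leq_mul (leqnn _) le) _; rewrite big_distrr /=.
  apply: (@leq_trans (\sum_(AB : {set V} * {set V} | big AB) 63 ^ (c * n) * W)).
    apply: leq_sum => -[A B] /andP[/= A8 B8]; rewrite card_configs_avoiding.
    rewrite -!expnMn cardsX card_ord leq_exp2r ?muln_gt0 ?n0 ?cE //.
    have := leq_mul A8 B8; rewrite mulnACA -[8 * 8]/64.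
    by move: (n * n) (#|A| * #|B|) => p q; lia.
  rewrite sum_nat_const leq_mul2r; apply/orP; right.
  apply: leq_trans (max_card _) _.
  by rewrite card_prod card_set_type card_ord -expnMn.
have gap : 4 ^ n * 4 ^ n * 63 ^ (c * n) <= 64 ^ (c * n).
  have := @exp_gap 63 (4 * n) isT; rewrite cE mulnA; congr (_ * _ <= _).
  by rewrite expnM -expnMn.
have : 4 ^ n * #|S| <= W.
  have pos : 0 < 4 ^ n * 63 ^ (c * n) by rewrite muln_gt0 !expn_gt0.
  rewrite -(leq_pmul2l pos) -[leqRHS]mulnA; apply: leq_trans bound.
  by rewrite mulnA leq_mul2r mulnAC gap orbT.
apply: leq_trans; rewrite leq_mul2r -{1}(expn1 4) leq_exp2l // n0 orbT.
by [].
Qed.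

Lemma good_config_exists g : 0 < n -> c = 64 * 4 ->
  exists f : config, ~~ separated f /\ #|loaded_sets g f| <= 2 * (16 * c) ^ g.+1.
Proof.
move=> n0 cE; have c0 : 0 < c by rewrite cE.
set S := [set f : config | separated f].
set L := [set f : config | 2 * (16 * c) ^ g.+1 < #|loaded_sets g f|].
have Wpos : 0 < (n * n) ^ (c * n) by rewrite expn_gt0 muln_gt0 n0.
have : #|S :|: L| < #|{: config}|.
  rewrite card_config.
  have arith (s l u w : nat) :
      0 < w -> 4 * s <= w -> 2 * l <= w -> u <= s + l -> u < w.
    lia.
  exact: arith Wpos (separated_rare n0 cE) (overloaded_rare g c0) (leq_card_setU S L).
rewrite -(cardsC (S :|: L)) -{1}[#|_|]addn0 ltn_add2l => /card_gt0P[f].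
by rewrite !inE negb_or -leqNgt => /andP[]; exists f.
Qed.

End Counting.

(** * From configurations to graphs *)

Lemma dense_slots (V : finType) m (f : {ffun 'I_m -> V * V}) (X : {set V}) :
  @dense (config_graph f) X -> #|X| <= #|slots f X|.
Proof.
case/andP=> _ /leq_trans/(_ (degree_sum_config f X)).
by rewrite leq_mul2l.
Qed.

Lemma sum_card_disjoint (I V : finType) (P : pred I) (X : I -> {set V}) :
  (forall i j, i != j -> [disjoint X i & X j]) -> \sum_(i | P i) #|X i| <= #|V|.
Proof.
move=> disj; under eq_bigr do rewrite -sum1_card big_mkcond /=.
rewrite exchange_big /= -sum1_card; apply: leq_sum => v _.
have [i /andP[Pi vi]|none] := pickP (fun i => P i && (v \in X i)).
  rewrite (bigD1 i) //= vi big1 ?addn0 // => j /andP[_ nji].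
  by rewrite (disjointFl (disj _ _ nji) vi).
by rewrite big1 // => i Pi; have := none i; rewrite Pi /= => ->.
Qed.

(** At most g vertices: the members of the packing are among the loaded sets,
    and pairwise different since disjoint and nonempty.  More than g vertices:
    they take up at least g + 1 of the n vertices each. *)
Lemma dense_packing_bound n c (f : {ffun 'I_(c * n) -> 'I_n * 'I_n}) g k :
  dense_packing k (config_graph f) -> k * g.+1 <= #|loaded_sets g f| * g.+1 + n.
Proof.
case=> X [Xd Xdisj].
pose small := [set i | #|X i| <= g].
have small_le : #|small| <= #|loaded_sets g f|.
  rewrite -(card_in_imset (f := X) (D := mem small)).
    apply/subset_leq_card/fintype.subsetP => _ /imsetP[i si ->].
    by move: si; rewrite !inE => -> /=; exact: dense_slots.
  move=> i j _ _ Xij; apply/eqP; apply: contraT => /Xdisj.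
  rewrite Xij -setI_eq0 finset.setIid -cards_eq0.
  by have /andP[] := Xd j; case: #|_|.
have large_le : #|~: small| * g.+1 <= n.
  have := sum_card_disjoint (mem (~: small)) Xdisj; rewrite card_ord.
  apply: leq_trans; rewrite -sum_nat_const; apply: leq_sum => i.
  by rewrite !inE -ltnNge.
have := cardsC small; rewrite card_ord => <-; rewrite mulnDl leq_add //.
by rewrite leq_mul2r small_le orbT.
Qed.

Lemma treewidth_unseparated n c (f : {ffun 'I_(c * n) -> 'I_n * 'I_n}) :
  ~~ separated f -> n < 8 * (treewidth (config_graph f)).+1.
Proof.
rewrite ltnNge; apply: contraNN => small.
have [|A [B [A8 B8 AB]]] := @small_treewidth_separation (config_graph f).
  by rewrite card_ord.
rewrite card_ord in A8 B8; apply/existsP; exists (A, B); rewrite A8 B8 /=.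
apply/forallP => i; apply/negP; case E: (f i) => [a b].
rewrite finset.in_setX /= => /andP[aA bB]; have [nab] := AB _ _ aA bB.
rewrite /= /config_mult (negPf nab) => /eqP.
by rewrite (bigD1 i) //= E eqxx.
Qed.

(** On g 2^(24 g) vertices, the loaded sets number at most
    2 (2^12)^(g + 1) <= (2^12)^(2 g) = 2^(24 g), and larger disjoint dense sets
    fewer than 2^(24 g). *)
Lemma sparse_packing_graph g : 1 < g ->
  exists G : mgraph,
    [/\ forall r, 1 < r -> ~ minor (copies (2 ^ (24 * g).+1) (theta r)) G
      & g * 2 ^ (24 * g) < 8 * (treewidth G).+1].
Proof.
move=> g1; set N := 2 ^ (24 * g); have N0 : 0 < N by rewrite expn_gt0.
have n0 : 0 < g * N by rewrite muln_gt0 N0 andbT ltnW.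
have [f [sep few]] := @good_config_exists (g * N) (64 * 4) g n0 erefl.
exists (config_graph f); split=> [r r1 mn|]; last exact: treewidth_unseparated.
have fewN : #|loaded_sets g f| <= N.
  apply: leq_trans few _; rewrite -[16 * _]/(2 ^ 12) -expnM -expnS leq_exp2l //.
  lia.
have := dense_packing_bound g (dense_packing_minor mn (dense_packing_theta _ r1)).
rewrite expnS -/N; apply/negP; rewrite -ltnNge.
apply: (@leq_ltn_trans (N * g.+1 + g * N)); last by nia.
by rewrite leq_add2r leq_mul2r fewN orbT.
Qed.


Import Order.TTheory GRing.Theory Num.Theory.

Local Open Scope classical_set_scope.
Local Open Scope ring_scope.

Theorem lemma5p12 (R : realType) :
  exists (k : nat -> nat) (G : nat -> mgraph),
    [/\ {homo k : i j / (i < j)%N},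
        (fun i : nat => (treewidth (G i))%:R : R)
          =Omega_\oo (fun i : nat => (k i)%:R * log2 ((k i)%:R : R))
      & forall r i : nat, (2 <= r)%N -> ~ minor (copies (k i) (theta r)) (G i)].
Proof.
(* The graph of index i uses g = i + 2, as [sparse_packing_graph] needs
   g > 1. *)
pose k i := (2 ^ (24 * i.+2).+1)%N.
have /choice[G GP] (i : nat) := @sparse_packing_graph i.+2 isT.
exists k, G; split=> [i j ij||r i r2]; last by case: (GP i) => + _; apply.
  by rewrite /k ltn_exp2l //; lia.
have log_k i : log2 ((k i)%:R : R) = (24 * i.+2).+1%:R.
  have ln2 : ln 2 != 0 :> R by rewrite gt_eqF // ln_gt0 // ltr1n.
  by rewrite /log2 /k natrX lnXn // mulrnAl divff.
(* With n the order of the graph: k log k <= 50 n, and n <= 16 tw since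
   n < 8 (tw + 1) and n >= 16. *)
have bound i : (k i * (24 * i.+2).+1 <= 800 * treewidth (G i))%N.
  have [_] := GP i; rewrite /k expnS; move: (treewidth _) => w.
  have : (16 <= 2 ^ (24 * i.+2))%N.
    by rewrite -[16%N]/(2 ^ 4)%N leq_exp2l //; lia.
  by move: (2 ^ _)%N => N; nia.
rewrite eqOmegaE qualifE /=; apply/asboolP; exists 800%:R^-1.
  by rewrite invr_gt0 ltr0n.
apply: nearW => i; rewrite log_k -natrM !ger0_norm // ler_pdivrMl ?ltr0n //.
by rewrite -natrM ler_nat.
Qed.
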